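(* Let $n\geq 4$ and let $\alpha=(a,b)\in W_{2^{n-1}-1,2}\subset\mathbb{A}_n\times\mathbb{A}_n=\mathbb{A}_{n+1}$. The following statements are equivalent. (i) $\alpha\in X_n$. (ii) $\alpha$ alternates with $\varepsilon$, i.e. $(\alpha,\alpha,\varepsilon)=0$ in $\mathbb{A}_{n+1}$. (iii) The vector subspace $V(\alpha;\varepsilon):=\mathrm{Span}\{e_0,\alpha,\varepsilon,\alpha\varepsilon\}$ of $\mathbb{A}_{n+1}$ is multiplicatively closed and isomorphic, as an algebra, to $\mathbb{A}_2=\mathbb{H}$ (the quaternions). (iv) $\mathbb{O}_\alpha$ is multiplicatively closed and isomorphic, as an algebra, to $\mathbb{A}_3=\mathbb{O}$ (the octonions). (v) $\hat\alpha\in\mathrm{Ker}\,L_\alpha\subset\mathbb{O}_\alpha^\perp$ (that is, $\hat\alpha\in\mathrm{Ker}\,L_\alpha$ and $\mathrm{Ker}\,L_\alpha\subset\mathbb{O}_\alpha^\perp$), where $L_\alpha:\mathbb{A}_{n+1}\to\mathbb{A}_{n+1}$ is left multiplication by $\alpha$.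
   Context: Cayley-Dickson algebras: $\mathbb{A}_0=\mathbb{R}$ with $\overline{x}=x$, and $\mathbb{A}_{m+1}=\mathbb{A}_m\times\mathbb{A}_m$ with product $(a,b)(x,y)=(ax-\overline{y}b,\;ya+b\overline{x})$ and conjugation $\overline{(x_1,x_2)}=(\overline{x}_1,-x_2)$. $\mathbb{A}_m=\mathbb{R}^{2^m}$ carries the standard inner product and norm; $\perp$ denotes orthogonality or orthogonal complement. $e_0$ is the unit of each algebra. For $m\geq1$, $\widetilde{e}_0:=(0,e_0)\in\mathbb{A}_m$ (the same symbol is used in each $\mathbb{A}_m$), and for $a=(a_1,a_2)\in\mathbb{A}_m$, $\widetilde{a}:=(-a_2,a_1)$. The doubly pure elements are $\widetilde{\mathbb{A}}_m=\{e_0,\widetilde{e}_0\}^\perp\subset\mathbb{A}_m$. The associator is $(x,y,z)=(xy)z-x(yz)$. $W_{2^{n-1}-1,2}=\{(a,b)\in\widetilde{\mathbb{A}}_n\times\widetilde{\mathbb{A}}_n:\ \|a\|=\|b\|=1,\ a\perp b,\ \widetilde{a}\perp b\}$. $X_n=\{(a,b)\in\mathbb{A}_n\times\mathbb{A}_n:\ \|a\|=\|b\|=1,\ ab=0\}$. $\varepsilon:=(\widetilde{e}_0,0)\in\mathbb{A}_{n+1}$, where here $\widetilde{e}_0\in\mathbb{A}_n$. For $\alpha\in\mathbb{A}_{n+1}$, $\mathbb{O}_\alpha:=\mathrm{Span}\{e_0,\widetilde{\varepsilon},\varepsilon,\widetilde{e}_0,\widetilde{\alpha},\alpha\varepsilon,\widetilde{\varepsilon}\alpha,\alpha\}\subset\mathbb{A}_{n+1}$.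 For $\alpha=(a,b)\in\mathbb{A}_n\times\mathbb{A}_n$, $\hat\alpha:=(b,a)$. *)

(* Defs.v *)
From HB Require Import structures.
From mathcomp Require Import all_boot all_order all_algebra.
From mathcomp Require Import all_classical all_reals.
Set Implicit Arguments.
Unset Strict Implicit.
Unset Printing Implicit Defensive.
Import Order.TTheory GRing.Theory Num.Theory.
Local Open Scope classical_set_scope.
Local Open Scope ring_scope.

(* The underlying real vector space of A_m.  [CD R m.+1] is convertible to
   [(CD R m * CD R m)%type], so its elements are literally pairs. *)
Fixpoint CD (R : realType) (m : nat) : vectType R :=
  if m is m'.+1 then (CD R m' * CD R m')%type else R^o.

Section CayleyDickson.
Variable R : realType.

Fixpoint cd_conj (m : nat) : CD R m -> CD R m :=
  match m return CD R m -> CD R m with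
  | 0%N => fun x => x
  | m'.+1 => fun x => (cd_conj x.1, - x.2)
  end.

Fixpoint cd_mul (m : nat) : CD R m -> CD R m -> CD R m :=
  match m return CD R m -> CD R m -> CD R m with
  | 0%N => fun a x : R^o => a * x
  | m'.+1 => fun a x =>
      (cd_mul a.1 x.1 - cd_mul (cd_conj x.2) a.2,
       cd_mul x.2 a.1 + cd_mul a.2 (cd_conj x.1))
  end.

Fixpoint cd_one (m : nat) : CD R m :=
  match m return CD R m with
  | 0%N => 1 : R^o
  | m'.+1 => (cd_one m', 0)
  end.

Fixpoint cd_dot (m : nat) : CD R m -> CD R m -> R :=
  match m return CD R m -> CD R m -> R with
  | 0%N => fun x y : R => x * y
  | m'.+1 => fun x y => cd_dot x.1 y.1 + cd_dot x.2 y.2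
  end.

Definition cd_norm (m : nat) (x : CD R m) : R := Num.sqrt (cd_dot x x).

Definition orth (m : nat) (x y : CD R m) : Prop := cd_dot x y = 0.

Definition orthC (m : nat) (S : set (CD R m)) : set (CD R m) :=
  [set x | forall y, S y -> orth x y].

(* Only meaningful for 0 < m; the value at m = 0 is junk. *)
Definition cd_tone (m : nat) : CD R m :=
  match m return CD R m with
  | 0%N => 0
  | m'.+1 => (0, cd_one m')
  end.

(* Only meaningful for 0 < m; the value at m = 0 is junk. *)
Definition cd_tilde (m : nat) : CD R m -> CD R m :=
  match m return CD R m -> CD R m with
  | 0%N => fun _ => 0
  | m'.+1 => fun a => (- a.2, a.1)
  end.

Definition doubly_pure (m : nat) : set (CD R m) :=
  orthC [set cd_one m; cd_tone m].

Definition associator (m : nat) (x y z : CD R m) : CD R m :=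
  cd_mul (cd_mul x y) z - cd_mul x (cd_mul y z).

(* W_{2^(n-1)-1,2} *)
Definition Wset (n : nat) : set (CD R n.+1) :=
  [set alpha | let: (a, b) := alpha in
    [/\ doubly_pure a /\ doubly_pure b, cd_norm a = 1 /\ cd_norm b = 1,
        orth a b & orth (cd_tilde a) b]].

Definition Xset (n : nat) : set (CD R n.+1) :=
  [set alpha | let: (a, b) := alpha in
    [/\ cd_norm a = 1, cd_norm b = 1 & cd_mul a b = 0]].

Definition cd_eps (n : nat) : CD R n.+1 := (cd_tone n, 0).

Definition cd_hat (n : nat) (alpha : CD R n.+1) : CD R n.+1 :=
  (alpha.2, alpha.1).

Definition Vspan (n : nat) (alpha : CD R n.+1) : {vspace CD R n.+1} :=
  <<[:: cd_one n.+1; alpha; cd_eps n; cd_mul alpha (cd_eps n)]>>%VS.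

Definition Ospan (n : nat) (alpha : CD R n.+1) : {vspace CD R n.+1} :=
  <<[:: cd_one n.+1; cd_tilde (cd_eps n); cd_eps n; cd_tone n.+1;
        cd_tilde alpha; cd_mul alpha (cd_eps n);
        cd_mul (cd_tilde (cd_eps n)) alpha; alpha]>>%VS.

Definition mul_closed (m : nat) (U : {vspace CD R m}) : Prop :=
  forall x y, x \in U -> y \in U -> cd_mul x y \in U.

(* U, with the product of A_m, is the image of A_k under an injective
   homomorphism of unital R-algebras. *)
Definition alg_isom (m : nat) (U : {vspace CD R m}) (k : nat) : Prop :=
  exists f : 'Hom(CD R k, CD R m),
    [/\ injective f, limg f = U, f (cd_one k) = cd_one m
      & forall x y, f (cd_mul x y) = cd_mul (f x) (f y)].

Definition KerL (m : nat) (alpha : CD R m) : set (CD R m) :=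
  [set x | cd_mul alpha x = 0].

End CayleyDickson.

Arguments cd_one R m : clear implicits.
Arguments cd_tone R m : clear implicits.
Arguments cd_eps R n : clear implicits.
Arguments Wset R n : clear implicits.
Arguments Xset R n : clear implicits.

(* Main.v *)
Require Import Defs.
From HB Require Import structures.
From mathcomp Require Import all_boot all_order all_algebra.
From mathcomp Require Import all_classical all_reals.
From mathcomp Require Import ring.
Set Implicit Arguments.
Unset Strict Implicit.
Unset Printing Implicit Defensive.
Import Order.TTheory GRing.Theory Num.Theory.
Local Open Scope classical_set_scope.
Local Open Scope ring_scope.

(* For doubly pure a, b as in the statement, alpha (alpha eps) equals -2 eps in
   its first component and 2 (ba)~ in its second one, so alpha alternates with
   eps exactly when ab = 0.  When ab = 0, the six vectors 1, ~e0, a, ~a, b, ~b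
   have a closed multiplication table in A_n, from which O_alpha is the image of
   A_3 = A_2 + A_2 l under u + v l |-> u + v (alpha / sqrt 2), and V(alpha; eps)
   is the image of a copy of A_2 inside A_3.  Conversely A_2 and A_3 are
   alternative, so an isomorphism in (iii) or (iv) forces alpha to alternate
   with eps.  Finally, if y in O_alpha and alpha x = 0, then
   alpha (alpha y) = -2 y and 0 = <alpha x, alpha y> = 2 <x, y>. *)

Local Notation "x ** y" := (cd_mul x y) (at level 40, left associativity).

(** * Bilinearity of the product, unit and conjugation *)

Section CayleyDicksonTheory.
Variable R : realType.
Implicit Types m k : nat.

Lemma cd_addE m (x y : CD R m.+1) : x + y = (x.1 + y.1, x.2 + y.2).
Proof. by []. Qed.

Lemma cd_oppE m (x : CD R m.+1) : - x = (- x.1, - x.2).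
Proof. by []. Qed.

Lemma cd_scaleE m c (x : CD R m.+1) : c *: x = (c *: x.1, c *: x.2).
Proof. by []. Qed.

Lemma cd_mulE m (x y : CD R m.+1) : x ** y =
  (x.1 ** y.1 - cd_conj y.2 ** x.2, y.2 ** x.1 + x.2 ** cd_conj y.1).
Proof. by []. Qed.

Lemma cd_conj_is_linear m : linear (@cd_conj R m).
Proof.
elim: m => [//|m IHm] c x y.
by rewrite /= !IHm opprD -scalerN.
Qed.

HB.instance Definition _ m :=
  GRing.isLinear.Build R (CD R m) (CD R m) *:%R (@cd_conj R m)
    (@cd_conj_is_linear m).

Lemma cd_conjB m (x y : CD R m) : cd_conj (x - y) = cd_conj x - cd_conj y.
Proof. exact: linearB. Qed.

Lemma cd_conjD m (x y : CD R m) : cd_conj (x + y) = cd_conj x + cd_conj y.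
Proof. exact: linearD. Qed.

Lemma cd_conjZ m c (x : CD R m) : cd_conj (c *: x) = c *: cd_conj x.
Proof. exact: linearZ. Qed.

Lemma cd_conjN m (x : CD R m) : cd_conj (- x) = - cd_conj x.
Proof. exact: linearN. Qed.

Lemma cd_conj0 m : cd_conj (0 : CD R m) = 0.
Proof. exact: linear0. Qed.

Lemma cd_conjK m : involutive (@cd_conj R m).
Proof. by elim: m => [//|m IHm] [x y] /=; rewrite IHm opprK. Qed.

(** The two linearities are proved in one induction: the doubling formula contains both [a.1 ** x.1]
    and [x.2 ** a.1], so each side at one level needs both sides at the level below. *)
Lemma cd_mul_linear_both m :
  (forall x : CD R m, linear (cd_mul x)) /\
  (forall y : CD R m, linear (fun x => cd_mul x y)).
Proof.
elim: m => [|m [IHl IHr]]; split.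
- by move=> x c y z; rewrite /= mulrDr scalerAr.
- by move=> x c y z; rewrite /= mulrDl scalerAl.
- move=> x c y z.
  rewrite [LHS]/= [RHS]/= !linearP /= !IHl !IHr.
  rewrite !cd_scaleE !cd_addE /= !scalerBr !scalerDr.
  by congr (_, _); rewrite ?opprD addrACA.
- move=> y c x z.
  rewrite [LHS]/= [RHS]/= !IHl !IHr.
  rewrite !cd_scaleE !cd_addE /= !scalerBr !scalerDr.
  by congr (_, _); rewrite ?opprD addrACA.
Qed.

HB.instance Definition _ m (x : CD R m) :=
  GRing.isLinear.Build R (CD R m) (CD R m) *:%R (cd_mul x)
    ((cd_mul_linear_both m).1 x).

Lemma cd_mulDr m (x y z : CD R m) : x ** (y + z) = x ** y + x ** z.
Proof. exact: linearD. Qed.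

Lemma cd_mulNr m (x y : CD R m) : x ** (- y) = - (x ** y).
Proof. exact: linearN. Qed.

Lemma cd_mul0r m (x : CD R m) : x ** 0 = 0.
Proof. exact: linear0. Qed.

Lemma cd_mulZr m c (x y : CD R m) : x ** (c *: y) = c *: (x ** y).
Proof. exact: linearZ. Qed.

Lemma cd_mulDl m (x y z : CD R m) : (x + y) ** z = x ** z + y ** z.
Proof. by have := (cd_mul_linear_both m).2 z 1 x y; rewrite !scale1r. Qed.

Lemma cd_mul0l m (x : CD R m) : 0 ** x = 0.
Proof. by apply: (addrI (0 ** x)); rewrite -cd_mulDl !addr0. Qed.

Lemma cd_mulZl m c (x y : CD R m) : (c *: x) ** y = c *: (x ** y).
Proof.
by have := (cd_mul_linear_both m).2 y c x 0; rewrite cd_mul0l !addr0.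
Qed.

Lemma cd_mulNl m (x y : CD R m) : (- x) ** y = - (x ** y).
Proof. by rewrite -scaleN1r cd_mulZl scaleN1r. Qed.

Lemma cd_conj1 m : cd_conj (cd_one R m) = cd_one R m.
Proof. by elim: m => [//|m IHm] /=; rewrite IHm oppr0. Qed.

Lemma cd_mul1r m (x : CD R m) : x ** cd_one R m = x.
Proof.
elim: m x => [x|m IHm [x y]] /=; first exact: mulr1.
by rewrite cd_conj0 cd_mul0l cd_conj1 !IHm subr0 cd_mul0l add0r.
Qed.

Lemma cd_mul1l m (x : CD R m) : cd_one R m ** x = x.
Proof.
elim: m x => [x|m IHm [x y]] /=; first exact: mul1r.
by rewrite IHm cd_mul0l cd_mul0r subr0 addr0 cd_mul1r.
Qed.

Lemma cd_conjM m (x y : CD R m) : cd_conj (x ** y) = cd_conj y ** cd_conj x.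
Proof.
elim: m x y => [x y|m IHm [a b] [x y]] /=; first exact: mulrC.
rewrite cd_conjB !IHm !cd_conjK cd_conjN !cd_mulNl !cd_mulNr opprK.
by congr (_, _); rewrite opprD addrC.
Qed.

(** * The inner product and its compatibility with the product *)

Lemma cd_dot_is_linear m (x : CD R m) : linear (cd_dot x : CD R m -> R^o).
Proof.
elim: m x => [|m IHm] x c y z; first by rewrite /= mulrDr scalerAr.
by rewrite /= !IHm scalerDr addrACA.
Qed.

HB.instance Definition _ m (x : CD R m) :=
  GRing.isLinear.Build R (CD R m) R^o *:%R (cd_dot x) (cd_dot_is_linear x).

Lemma cd_dotC m (x y : CD R m) : cd_dot x y = cd_dot y x.
Proof.
by elim: m x y => [|m IHm] x y /=; [exact: mulrC | rewrite !(IHm x.1, IHm x.2)].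
Qed.

Lemma cd_dotDr m (x y z : CD R m) : cd_dot x (y + z) = cd_dot x y + cd_dot x z.
Proof. exact: linearD. Qed.

Lemma cd_dotNr m (x y : CD R m) : cd_dot x (- y) = - cd_dot x y.
Proof. exact: linearN. Qed.

Lemma cd_dotZr m c (x y : CD R m) : cd_dot x (c *: y) = c * cd_dot x y.
Proof. exact: linearZ. Qed.

Lemma cd_dotDl m (x y z : CD R m) : cd_dot (x + y) z = cd_dot x z + cd_dot y z.
Proof. by rewrite !(cd_dotC _ z) cd_dotDr. Qed.

Lemma cd_dotNl m (x y : CD R m) : cd_dot (- x) y = - cd_dot x y.
Proof. by rewrite !(cd_dotC _ y) cd_dotNr. Qed.

Lemma cd_dot0l m (x : CD R m) : cd_dot 0 x = 0.
Proof. by rewrite cd_dotC; exact: linear0. Qed.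

Lemma cd_dot_ge0 m (x : CD R m) : 0 <= cd_dot x x.
Proof. by elim: m x => [|m IHm] x /=; [exact: sqr_ge0 | rewrite addr_ge0]. Qed.

Lemma cd_dot_eq0 m (x : CD R m) : cd_dot x x = 0 -> x = 0.
Proof.
elim: m x => [|m IHm] x /=; first by move/eqP; rewrite mulf_eq0 orbb => /eqP.
move/eqP; rewrite paddr_eq0 ?cd_dot_ge0 // => /andP[/eqP/IHm x1 /eqP/IHm x2].
by rewrite [x]surjective_pairing x1 x2.
Qed.

Lemma cd_dot_conj m (x y : CD R m) :
  cd_dot (cd_conj x) (cd_conj y) = cd_dot x y.
Proof.
by elim: m x y => [//|m IHm] x y /=; rewrite IHm cd_dotNl cd_dotNr opprK.
Qed.

Lemma cd_dot_conjl m (x y : CD R m) :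
  cd_dot (cd_conj x) y = cd_dot x (cd_conj y).
Proof. by rewrite -[in RHS]cd_dot_conj cd_conjK. Qed.

Lemma cd_dot_mull m (x y z : CD R m) :
  cd_dot (x ** y) z = cd_dot y (cd_conj x ** z).
Proof.
elim: m x y z => [x y z|m IHm [a b] [x y] [z w]] /=.
  by rewrite mulrA (mulrC x).
(* Conjugation is an isometry reversing products, so the induction hypothesis on left multiplication
   also gives the adjoint of right multiplication. *)
have dot_mulr (u v t : CD R m) : cd_dot (u ** v) t = cd_dot u (t ** cd_conj v).
  by rewrite -cd_dot_conj cd_conjM IHm cd_conjK cd_dot_conjl cd_conjM cd_conjK.
rewrite !cd_mulNl !cd_mulNr opprK !cd_dotDr !cd_dotDl !cd_dotNl cd_dotNr.
rewrite (IHm a) (dot_mulr (cd_conj y)) (dot_mulr y) (IHm b) !cd_dot_conjl.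
rewrite !cd_conjM !cd_conjK.
by ring.
Qed.

Lemma cd_mul_conj m (x : CD R m) : x ** cd_conj x = cd_dot x x *: cd_one R m.
Proof.
elim: m x => [x|m IHm [a b]]; first by rewrite /= [RHS]mulr1.
rewrite cd_scaleE /= IHm cd_conjN cd_mulNl opprK cd_conjK.
(* The doubled product contains [cd_conj b ** b] in this order, which is the induction hypothesis at
   [cd_conj b]. *)
have := IHm (cd_conj b); rewrite cd_conjK cd_dot_conj => ->.
by rewrite -scalerDl cd_mulNl addNr scaler0.
Qed.

(** * Pure elements: squares and anticommutation *)

Lemma cd_conj_pure m (x : CD R m) :
  cd_dot x (cd_one R m) = 0 -> cd_conj x = - x.
Proof.
elim: m x => [x|m IHm [a b]] /=; first by rewrite mulr1 => ->; rewrite oppr0.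
by rewrite linear0 addr0 => /IHm ->.
Qed.

Lemma cd_sqr_pure m (x : CD R m) :
  cd_conj x = - x -> x ** x = - (cd_dot x x *: cd_one R m).
Proof. by move=> px; rewrite -cd_mul_conj px cd_mulNr opprK. Qed.

(** Polarisation of [cd_sqr_pure]: expand the square of the pure element [x + y] and cancel the
    squares of [x] and [y]. *)
Lemma cd_anticomm m (x y : CD R m) : cd_conj x = - x -> cd_conj y = - y ->
  cd_dot x y = 0 -> y ** x = - (x ** y).
Proof.
move=> px py xy0; have pxy : cd_conj (x + y) = - (x + y).
  by rewrite linearD /= px py opprD.
have := cd_sqr_pure pxy; rewrite cd_mulDl !cd_mulDr !cd_dotDl !cd_dotDr.
rewrite (cd_dotC y x) xy0 addr0 add0r (cd_sqr_pure px) (cd_sqr_pure py).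
rewrite scalerDl opprD -addrA => /addrI; rewrite addrA -[RHS]add0r => /addIr.
by move/eqP; rewrite addrC addr_eq0 => /eqP.
Qed.

Lemma cd_double_eq0 m (x : CD R m) : x + x = 0 -> x = 0.
Proof.
move/eqP; rewrite -mulr2n -scaler_nat scaler_eq0 pnatr_eq0.
by case/orP=> // /eqP.
Qed.

(** * Subalgebras isomorphic to some A_k, and alternativity of A_2 and A_3 *)

Lemma alg_isom_mul_closed m k (U : {vspace CD R m}) :
  alg_isom U k -> mul_closed U.
Proof.
case=> f [_ <- _ fM] _ _ /memv_imgP[x _ ->] /memv_imgP[y _ ->].
by rewrite -fM memv_img ?memvf.
Qed.

Lemma alg_isom_alternative m k (U : {vspace CD R m}) :
  (forall x y : CD R k, associator x x y = 0) -> alg_isom U k ->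
  {in U &, forall x y, associator x x y = 0}.
Proof.
move=> alt [f [_ <- _ fM]] _ _ /memv_imgP[x _ ->] /memv_imgP[y _ ->].
by rewrite /associator -!fM -linearB /= [X in f X]alt linear0.
Qed.

(* A homomorphism out of a Cayley-Dickson algebra is injective because
   [x ** cd_conj x] is a nonzero multiple of the unit when [x] is nonzero. *)
Lemma alg_isom_span m k (f : {linear CD R k -> CD R m}) (X : seq (CD R m)) :
  cd_one R m != 0 -> f (cd_one R k) = cd_one R m ->
  {morph f : x y / x ** y >-> x ** y} -> (forall x, f x \in <<X>>%VS) ->
  (forall v, v \in X -> exists x, v = f x) -> alg_isom <<X>>%VS k.
Proof.
move=> one_neq0 f1 fM fX Xf; exists (linfun f); split.
- apply: raddf_inj => x; rewrite [LHS]lfunE /= => fx0.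
  apply: cd_dot_eq0; have := congr1 f (cd_mul_conj x).
  rewrite fM fx0 cd_mul0l linearZ /= f1 => /esym/eqP.
  by rewrite scaler_eq0 (negPf one_neq0) orbF => /eqP.
- apply/eqP; rewrite eqEsubv; apply/andP; split.
    by apply/subvP => _ /memv_imgP[x _ ->]; rewrite lfunE.
  apply/span_subvP => v /Xf[x ->].
  by rewrite -[f x](lfunE f) memv_img ?memvf.
- by rewrite lfunE.
- by move=> x y; rewrite !lfunE /= fM.
Qed.

Lemma cd_one_neq0 m : cd_one R m != 0.
Proof.
elim: m => [|m IHm]; first exact: oner_neq0.
by apply: contraNneq IHm => -[->].
Qed.

(** Here and for the octonions, unfolding to real coordinates leaves one polynomial identity per
    coordinate. *)
Lemma quaternion_alternative (x y : CD R 2) : associator x x y = 0.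
Proof.
case: x => [[x0 x1] [x2 x3]]; case: y => [[y0 y1] [y2 y3]].
rewrite /associator /=; apply/eqP; rewrite subr_eq0; apply/eqP.
by congr (_, _, (_, _)); rewrite /=; ring.
Qed.

Lemma octonion_alternative (x y : CD R 3) : associator x x y = 0.
Proof.
case: x => [[[x0 x1] [x2 x3]] [[x4 x5] [x6 x7]]].
case: y => [[[y0 y1] [y2 y3]] [[y4 y5] [y6 y7]]].
rewrite /associator /=; apply/eqP; rewrite subr_eq0; apply/eqP.
by congr (_, _, (_, _), (_, _, (_, _))); rewrite /=; ring.
Qed.

End CayleyDicksonTheory.

(** * The tilde map and doubly pure elements *)

Section DoublyPure.
Variables (R : realType) (m : nat).
Implicit Types x y : CD R m.+1.

Local Notation J := (cd_tone R m.+1).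

Lemma cd_tilde_is_linear : linear (@cd_tilde R m.+1).
Proof. by move=> c x y; rewrite /= opprD -scalerN. Qed.

HB.instance Definition _ :=
  GRing.isLinear.Build R (CD R m.+1) (CD R m.+1) *:%R (@cd_tilde R m.+1)
    cd_tilde_is_linear.

Lemma cd_tildeN x : cd_tilde (- x) = - cd_tilde x.
Proof. exact: linearN. Qed.

Lemma cd_tildeK x : cd_tilde (cd_tilde x) = - x.
Proof. by []. Qed.

Lemma cd_tilde_eq0 x : cd_tilde x = 0 -> x = 0.
Proof.
move=> x0; have := cd_tildeK x; rewrite x0 linear0 => /esym/eqP.
by rewrite oppr_eq0 => /eqP.
Qed.

Lemma cd_dot_tilde x y : cd_dot (cd_tilde x) (cd_tilde y) = cd_dot x y.
Proof. by rewrite /= cd_dotNl cd_dotNr opprK addrC. Qed.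

Lemma cd_mul_tone x : x ** J = cd_tilde x.
Proof.
by rewrite /= cd_mul0r cd_conj1 cd_conj0 cd_mul0r !cd_mul1l sub0r addr0.
Qed.

Lemma cd_conj_tone : cd_conj J = - J.
Proof. by rewrite /= cd_conj0 cd_oppE /= oppr0. Qed.

(** Orthogonality to [cd_one] kills the real part of the first half, orthogonality to [cd_tone] that
    of the second. In this equational form, conjugates of the halves rewrite to signs. *)
Definition dpure x := cd_conj x.1 = - x.1 /\ cd_conj x.2 = - x.2.

Lemma doubly_pureP x : doubly_pure x -> dpure x.
Proof.
move=> xP; split; apply: cd_conj_pure.
- have := xP (cd_one R m.+1) (or_introl erefl).
  by rewrite /orth /= (cd_dotC x.2) cd_dot0l addr0.
- have := xP J (or_intror erefl).
  by rewrite /orth /= (cd_dotC x.1) cd_dot0l add0r.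
Qed.

Lemma dpure_conj x : dpure x -> cd_conj x = - x.
Proof. by case=> x1 _; rewrite /= x1. Qed.

Lemma dpure_tilde x : dpure x -> dpure (cd_tilde x).
Proof. by case=> x1 x2; split; rewrite /= ?cd_conjN ?x1 ?x2. Qed.

Lemma cd_tone_mul x : dpure x -> J ** x = - cd_tilde x.
Proof.
case=> x1 x2; rewrite /= !cd_mul0l cd_mul0r add0r cd_mul1r cd_mul1l x1 x2.
by rewrite cd_oppE /= sub0r opprK.
Qed.

(** Once the conjugates of the halves of [y] become signs, both sides have the same four terms. *)
Lemma cd_mul_tildel x y : dpure y -> cd_tilde x ** y = - cd_tilde (x ** y).
Proof.
case=> y1 y2; rewrite [LHS]/= cd_oppE /= y1 y2 opprK.
rewrite !cd_mulNl !cd_mulNr !opprK addrC; congr (_, _).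
by rewrite opprD addrC.
Qed.

(** With [cd_mul_tone] and [cd_tone_mul], this makes [1], [J], [x] and [cd_tilde x] multiply like
    the quaternion units. *)
Lemma cd_mul_tilde_self x : dpure x ->
  cd_dot x x = 1 -> cd_tilde x ** x = J /\ x ** cd_tilde x = - J.
Proof.
move=> px xx; have xJ : cd_tilde x ** x = J.
  rewrite cd_mul_tildel // cd_sqr_pure ?dpure_conj // xx scale1r.
  by rewrite cd_tildeN opprK /= oppr0.
split=> //; rewrite -xJ; apply: cd_anticomm; do ?exact: dpure_conj.
  by apply/dpure_conj/dpure_tilde.
by rewrite /= cd_dotNl (cd_dotC x.2) addNr.
Qed.

End DoublyPure.

(** * The multiplication table of [1], [J], [a], [b] and the tildes of [a] and [b] *)

Section Frame.
Variables (R : realType) (m : nat) (a b : CD R m.+1).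

Local Notation J := (cd_tone R m.+1).

(** Computing with coefficients reduces products of such combinations to identities between real
    numbers. *)
Definition frame_comb (s t p q r w : R) : CD R m.+1 :=
  s *: cd_one R m.+1 + t *: J + p *: a + q *: cd_tilde a
  + r *: b + w *: cd_tilde b.

Lemma frame_combD s t p q r w s' t' p' q' r' w' :
  frame_comb s t p q r w + frame_comb s' t' p' q' r' w' =
  frame_comb (s + s') (t + t') (p + p') (q + q') (r + r') (w + w').
Proof.
rewrite /frame_comb !scalerDl (addrACA _ (w *: _)) (addrACA _ (r *: _)).
by rewrite (addrACA _ (q *: _)) (addrACA _ (p *: _)) (addrACA _ (t *: _)).
Qed.

Lemma frame_combZ c s t p q r w : c *: frame_comb s t p q r w =
  frame_comb (c * s) (c * t) (c * p) (c * q) (c * r) (c * w).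
Proof. by rewrite /frame_comb !scalerDr !scalerA. Qed.

Lemma frame_combN s t p q r w :
  - frame_comb s t p q r w = frame_comb (- s) (- t) (- p) (- q) (- r) (- w).
Proof. by rewrite -scaleN1r frame_combZ !mulN1r. Qed.

Hypotheses (pa : dpure a) (pb : dpure b).

Lemma frame_comb_conj s t p q r w :
  cd_conj (frame_comb s t p q r w) =
  frame_comb s (- t) (- p) (- q) (- r) (- w).
Proof.
have [ca cb] := (dpure_conj pa, dpure_conj pb).
have ca' := dpure_conj (dpure_tilde pa).
have cb' := dpure_conj (dpure_tilde pb).
rewrite /frame_comb !cd_conjD !cd_conjZ cd_conj1.
by rewrite cd_conj_tone ca ca' cb cb' !scalerN !scaleNr.
Qed.

Hypotheses (aa : cd_dot a a = 1) (bb : cd_dot b b = 1).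
Hypotheses (ab : cd_dot a b = 0) (ab' : cd_dot (cd_tilde a) b = 0).
Hypothesis (ab0 : a ** b = 0).

(** The relation [ab0] spreads to all eight products: [cd_mul_tildel] moves a tilde out of the left
    factor, and anticommutation of orthogonal pure elements swaps the factors. *)
Lemma frame_mul0 : [/\ [/\ a ** b = 0, a ** cd_tilde b = 0,
    cd_tilde a ** b = 0 & cd_tilde a ** cd_tilde b = 0] &
  [/\ b ** a = 0, b ** cd_tilde a = 0,
    cd_tilde b ** a = 0 & cd_tilde b ** cd_tilde a = 0]].
Proof.
have [ca cb] := (dpure_conj pa, dpure_conj pb).
have [pa' pb'] := (dpure_tilde pa, dpure_tilde pb).
have [ca' cb'] := (dpure_conj pa', dpure_conj pb').
have ba0 : b ** a = 0 by rewrite (cd_anticomm ca cb) // ab0 oppr0.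
have a'b0 : cd_tilde a ** b = 0.
  by rewrite (cd_mul_tildel _ pb) ab0 linear0 oppr0.
have b'a0 : cd_tilde b ** a = 0.
  by rewrite (cd_mul_tildel _ pa) ba0 linear0 oppr0.
have ba'0 : b ** cd_tilde a = 0 by rewrite (cd_anticomm ca' cb) // a'b0 oppr0.
have ab'0 : a ** cd_tilde b = 0.
  rewrite (cd_anticomm cb' ca) ?b'a0 ?oppr0 //.
  by rewrite cd_dotC -cd_dot_tilde cd_tildeK cd_dotNr ab' oppr0.
have a'b'0 : cd_tilde a ** cd_tilde b = 0.
  by rewrite (cd_mul_tildel _ pb') ab'0 linear0 oppr0.
have b'a'0 : cd_tilde b ** cd_tilde a = 0.
  by rewrite (cd_mul_tildel _ pa') ba'0 linear0 oppr0.
by [].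
Qed.

Lemma tone_sqr : J ** J = - cd_one R m.+1.
Proof. by rewrite cd_mul_tone cd_oppE /= oppr0. Qed.

Lemma mul_tone_frame_comb s t p q r w :
  J ** frame_comb s t p q r w = frame_comb (- t) s q (- p) w (- r).
Proof.
rewrite /frame_comb !cd_mulDr !cd_mulZr cd_mul1r tone_sqr !cd_tone_mul //;
  do ?exact: dpure_tilde.
by rewrite !cd_tildeK !opprK !scalerN !scaleNr [LHS](ACl (2*1*4*3*6*5)).
Qed.

Lemma mul_a_frame_comb s t p q r w :
  a ** frame_comb s t p q r w = frame_comb (- p) (- q) s t 0 0.
Proof.
have [[_ ab'0 _ _] _] := frame_mul0; have [_ aa'] := cd_mul_tilde_self pa aa.
rewrite /frame_comb !cd_mulDr !cd_mulZr cd_mul1r cd_mul_tone ab0 ab'0 aa'.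
rewrite cd_sqr_pure ?dpure_conj // aa scale1r !scaler0 !scale0r !addr0.
by rewrite !scalerN !scaleNr [LHS](ACl (3*4*1*2)).
Qed.

Lemma mul_tilde_a_frame_comb s t p q r w :
  cd_tilde a ** frame_comb s t p q r w = frame_comb (- q) p (- t) s 0 0.
Proof.
have [[_ _ a'b0 a'b'0] _] := frame_mul0.
have [a'a _] := cd_mul_tilde_self pa aa.
rewrite /frame_comb !cd_mulDr !cd_mulZr cd_mul1r cd_mul_tone a'b0 a'b'0 a'a.
rewrite cd_sqr_pure; last exact/dpure_conj/dpure_tilde.
rewrite cd_dot_tilde aa scale1r cd_tildeK !scaler0 !scale0r !addr0.
by rewrite !scalerN !scaleNr [LHS](ACl (4*3*2*1)).
Qed.

Lemma mul_b_frame_comb s t p q r w :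
  b ** frame_comb s t p q r w = frame_comb (- r) (- w) 0 0 s t.
Proof.
have [_ [ba0 ba'0 _ _]] := frame_mul0; have [_ bb'] := cd_mul_tilde_self pb bb.
rewrite /frame_comb !cd_mulDr !cd_mulZr cd_mul1r cd_mul_tone ba0 ba'0 bb'.
rewrite cd_sqr_pure ?dpure_conj // bb scale1r !scaler0 !scale0r !addr0.
by rewrite !scalerN !scaleNr [LHS](ACl (3*4*1*2)).
Qed.

Lemma mul_tilde_b_frame_comb s t p q r w :
  cd_tilde b ** frame_comb s t p q r w = frame_comb (- w) r 0 0 (- t) s.
Proof.
have [_ [_ _ b'a0 b'a'0]] := frame_mul0.
have [b'b _] := cd_mul_tilde_self pb bb.
rewrite /frame_comb !cd_mulDr !cd_mulZr cd_mul1r cd_mul_tone b'a0 b'a'0 b'b.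
rewrite cd_sqr_pure; last exact/dpure_conj/dpure_tilde.
rewrite cd_dot_tilde bb scale1r cd_tildeK !scaler0 !scale0r !addr0.
by rewrite !scalerN !scaleNr [LHS](ACl (4*3*2*1)).
Qed.

(** Two quaternion products sharing [1] and [J]; by [frame_mul0] there are no cross terms between
    the [a] part and the [b] part. *)
Lemma frame_combM s t p q r w s' t' p' q' r' w' :
  frame_comb s t p q r w ** frame_comb s' t' p' q' r' w' =
  frame_comb (s * s' - t * t' - p * p' - q * q' - r * r' - w * w')
             (s * t' + t * s' - p * q' + q * p' - r * w' + w * r')
             (s * p' + p * s' + t * q' - q * t')
             (s * q' + q * s' - t * p' + p * t')
             (s * r' + r * s' + t * w' - w * t')
             (s * w' + w * s' - t * r' + r * t').
Proof.
rewrite {1}/frame_comb !cd_mulDl !cd_mulZl cd_mul1l.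
rewrite mul_tone_frame_comb mul_a_frame_comb mul_tilde_a_frame_comb.
rewrite mul_b_frame_comb mul_tilde_b_frame_comb !frame_combZ !frame_combD.
by f_equal; ring.
Qed.

(** * The isomorphisms onto O_alpha and V(alpha; eps) when [a ** b = 0] *)

Local Notation alpha := ((a, b) : CD R m.+2).
Local Notation eps := (cd_eps R m.+1).

(* The map (u, v) |-> u + v ** (c *: alpha), with c = 1 / sqrt 2 later on so
   that [c *: alpha] has norm one; here the
   quaternions are identified with the span of [1], [eps], [cd_tone] and [cd_tilde eps]. *)
Definition octonion_map (c : R) (x : CD R 3) : CD R m.+2 :=
  let: (((s, t), (s', t')), ((p, q), (r, w))) := x in
  (frame_comb s t (c * p) (- (c * q)) (c * r) (c * w),
   frame_comb s' t' (- (c * r)) (c * w) (c * p) (c * q)).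

Lemma octonion_map_is_linear c : linear (octonion_map c).
Proof.
move=> k [[[x0 x1] [x2 x3]] [[x4 x5] [x6 x7]]].
move=> [[[y0 y1] [y2 y3]] [[y4 y5] [y6 y7]]].
rewrite [RHS]cd_addE cd_scaleE [LHS]/= [RHS]/=.
rewrite !frame_combZ !frame_combD /GRing.scale /=.
by f_equal; f_equal; ring.
Qed.

HB.instance Definition _ c :=
  GRing.isLinear.Build R (CD R 3) (CD R m.+2) *:%R (octonion_map c)
    (octonion_map_is_linear c).

Lemma octonion_map1 c : octonion_map c (cd_one R 3) = cd_one R m.+2.
Proof.
by rewrite /= !mulr0 oppr0 /frame_comb !scale0r !addr0 scale1r.
Qed.

Lemma octonion_mapM c : c * c = 2^-1 ->
  {morph octonion_map c : x y / x ** y >-> x ** y}.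
Proof.
move=> hc [[[x0 x1] [x2 x3]] [[x4 x5] [x6 x7]]].
move=> [[[y0 y1] [y2 y3]] [[y4 y5] [y6 y7]]].
rewrite [LHS]/= [RHS]cd_mulE; cbv [octonion_map fst snd].
have hcc u v : c * u * (c * v) = 2^-1 * (u * v) by rewrite mulrACA hc.
rewrite !frame_comb_conj !frame_combM !frame_combN !frame_combD.
(* Coefficients of [a], [b] and their tildes are of degree one in [c], and [ring] closes them. Those
   of [1] and [J] contain [c * c], with each such product arising twice, once from each half of the
   doubling formula; hence the value 1/2. *)
by f_equal; f_equal; first [ring | rewrite ?(mulrN, mulNr) ?opprK !hcc; field].
Qed.

Lemma mul_eps : alpha ** eps = (cd_tilde a, - cd_tilde b).
Proof.
rewrite [LHS]cd_mulE; cbv [cd_eps fst snd].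
rewrite cd_conj0 !cd_mul0l subr0 add0r cd_mul_tone.
by rewrite cd_conj_tone cd_mulNr cd_mul_tone.
Qed.

Lemma tilde_eps_mul : cd_tilde eps ** alpha = (cd_tilde b, cd_tilde a).
Proof.
rewrite [LHS]cd_mulE; cbv [cd_eps cd_tilde fst snd]; fold (cd_tilde a).
rewrite oppr0 cd_mul0l cd_mul0r !dpure_conj // cd_mulNl cd_mulNr opprK.
by rewrite cd_mul_tone cd_tone_mul // opprK !add0r.
Qed.

(** This displays the image on the generators of [Ospan], which yields both membership in the span
    and the preimages of the generators. *)
Lemma octonion_mapE c s t s' t' p q r w :
  octonion_map c (((s, t), (s', t')), ((p, q), (r, w))) =
  s *: cd_one R m.+2 + t *: eps + s' *: cd_tone R m.+2
  + t' *: cd_tilde eps + (c * p) *: alpha - (c * q) *: (alpha ** eps)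
  - (c * r) *: cd_tilde alpha + (c * w) *: (cd_tilde eps ** alpha).
Proof.
rewrite mul_eps tilde_eps_mul.
(* The right-hand side is convertible to this pair, so only zeros, signs and the order of terms
   remain. *)
transitivity ((s *: cd_one R m.+1 + t *: J + s' *: 0 + t' *: - 0 + (c * p) *: a
    - (c * q) *: cd_tilde a - (c * r) *: - b + (c * w) *: cd_tilde b,
  s *: 0 + t *: 0 + s' *: cd_one R m.+1 + t' *: J + (c * p) *: b
    - (c * q) *: - cd_tilde b - (c * r) *: a + (c * w) *: cd_tilde a)
  : CD R m.+2); last exact: erefl.
rewrite /octonion_map /frame_comb !oppr0 !scaler0 !addr0 !add0r.
rewrite !scalerN !scaleNr !opprK; congr (_, _).
by rewrite [RHS](ACl (1*2*5*6*3*4)).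
Qed.

Lemma invsqrt2P (c := (Num.sqrt 2)^-1 : R) : c * c = 2^-1 /\ c != 0.
Proof.
split; first by rewrite -invfM -expr2 sqr_sqrtr.
by rewrite invr_neq0 // gt_eqF // sqrtr_gt0.
Qed.

Lemma alg_isom_Ospan : alg_isom (Ospan alpha) 3.
Proof.
set c : R := (Num.sqrt 2)^-1.
have [hc c0] : c * c = 2^-1 /\ c != 0 := invsqrt2P.
apply: (@alg_isom_span R _ _ (octonion_map c)).
- exact: cd_one_neq0.
- exact: octonion_map1.
- exact: octonion_mapM.
- move=> [[[s t] [s' t']] [[p q] [r w]]].
  rewrite [X in X \in _]octonion_mapE.
  do ![rewrite rpredD // | rewrite rpredN // | rewrite rpredZ //];
    by apply: memv_span; rewrite !inE eqxx ?orbT.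
- move=> v; rewrite !inE.
  do ?[case/predU1P => [->|]]; last move/eqP=> ->.
  (* Preimages in the order of the list in [Ospan]: [c^-1] cancels the scaling of the last four
     coordinates, and the minus signs match those in [octonion_mapE]. *)
  all: [> exists (((1, 0), (0, 0)), ((0, 0), (0, 0)))
        | exists (((0, 0), (0, 1)), ((0, 0), (0, 0)))
        | exists (((0, 1), (0, 0)), ((0, 0), (0, 0)))
        | exists (((0, 0), (1, 0)), ((0, 0), (0, 0)))
        | exists (((0, 0), (0, 0)), ((0, 0), (- c^-1, 0)))
        | exists (((0, 0), (0, 0)), ((0, - c^-1), (0, 0)))
        | exists (((0, 0), (0, 0)), ((0, 0), (0, c^-1)))
        | exists (((0, 0), (0, 0)), ((c^-1, 0), (0, 0)))].
  all: rewrite [RHS]octonion_mapE !(mulr0, mulrN, scale0r, scaleNr) ?mulfV //.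
  all: by rewrite !(opprK, oppr0, addr0, add0r) scale1r.
Qed.

(* The double of the inclusion of A_1 in A_2. *)
Definition quaternion_incl (x : CD R 2) : CD R 3 := ((x.1, 0), (x.2, 0)).

Lemma quaternion_incl_is_linear : linear quaternion_incl.
Proof.
move=> k x y; transitivity (((k *: x.1 + y.1, k *: 0 + 0),
  (k *: x.2 + y.2, k *: 0 + 0)) : CD R 3); last exact: erefl.
by rewrite scaler0 addr0.
Qed.

HB.instance Definition _ :=
  GRing.isLinear.Build R (CD R 2) (CD R 3) *:%R quaternion_incl
    quaternion_incl_is_linear.

Lemma quaternion_inclM : {morph quaternion_incl : x y / x ** y >-> x ** y}.
Proof.
move=> [[x0 x1] [x2 x3]] [[y0 y1] [y2 y3]]; rewrite /quaternion_incl /=.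
by congr (_, _, (_, _), (_, _, (_, _))); rewrite /=; ring.
Qed.

Lemma alg_isom_Vspan : alg_isom (Vspan alpha) 2.
Proof.
set c : R := (Num.sqrt 2)^-1.
have [hc c0] : c * c = 2^-1 /\ c != 0 := invsqrt2P.
(* On the included quaternions only the four generators of [Vspan] survive. *)
have mapE s t p q : octonion_map c (quaternion_incl ((s, t), (p, q))) =
    s *: cd_one R m.+2 + t *: eps + (c * p) *: alpha
    - (c * q) *: (alpha ** eps).
  rewrite [LHS]octonion_mapE.
  by rewrite !(mulr0, scale0r, oppr0, addr0).
apply: (@alg_isom_span R _ _ (octonion_map c \o quaternion_incl)).
- exact: cd_one_neq0.
- exact: octonion_map1.
- move=> x y; apply: etrans (octonion_mapM hc _ _).
  exact: congr1 (quaternion_inclM x y).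
- move=> [[s t] [p q]]; rewrite [X in X \in _]mapE.
  do ![rewrite rpredD // | rewrite rpredN // | rewrite rpredZ //];
    by apply: memv_span; rewrite !inE eqxx ?orbT.
- move=> v; rewrite !inE.
  do ?[case/predU1P => [->|]]; last move/eqP=> ->.
  all: [> exists ((1, 0), (0, 0))
        | exists ((0, 0), (c^-1, 0))
        | exists ((0, 1), (0, 0))
        | exists ((0, 0), (0, - c^-1))].
  all: rewrite [RHS]mapE !(mulr0, mulrN, scale0r, scaleNr) ?mulfV //.
  all: by rewrite !(opprK, oppr0, addr0, add0r) scale1r.
Qed.

End Frame.

(** * Consequences of alternativity: recovering [a ** b = 0], and the kernel of left
    multiplication *)

Section ZeroDivisors.
Variables (R : realType) (m : nat) (a b : CD R m.+1).

Local Notation alpha := ((a, b) : CD R m.+2).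
Local Notation eps := (cd_eps R m.+1).

Hypotheses (pa : dpure a) (pb : dpure b).
Hypotheses (aa : cd_dot a a = 1) (bb : cd_dot b b = 1).
Hypotheses (ab : cd_dot a b = 0) (ab' : cd_dot (cd_tilde a) b = 0).

Lemma alpha_conj : cd_conj alpha = - alpha.
Proof. by rewrite [LHS]/= -/(cd_conj a) dpure_conj. Qed.

Lemma alpha_mul_alpha : alpha ** alpha = - (2 *: cd_one R m.+2).
Proof.
rewrite cd_sqr_pure; last exact: alpha_conj.
rewrite (_ : cd_dot alpha alpha = 2) //.
by rewrite [LHS]/= -/(cd_dot a a) -/(cd_dot b b) aa bb.
Qed.

Lemma alternative_alpha_mulK x :
  associator alpha alpha x = 0 -> alpha ** (alpha ** x) = - (2 *: x).
Proof.
move/eqP; rewrite subr_eq0 => /eqP <-.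
by rewrite alpha_mul_alpha cd_mulNl cd_mulZl cd_mul1l.
Qed.

Lemma alternative_eps_mul0 : associator alpha alpha eps = 0 -> a ** b = 0.
Proof.
have [ca cb] := (dpure_conj pa, dpure_conj pb).
have ca' := dpure_conj (dpure_tilde pa).
move/alternative_alpha_mulK; rewrite mul_eps [LHS]cd_mulE.
cbv [fst snd] => /(congr1 snd) h.
(* The second half of [eps] is zero, so the second half of [alpha ** (alpha ** eps)] vanishes; it
   equals -2 times the tilde of [a ** b]. *)
have {h} : - cd_tilde b ** a + b ** cd_conj (cd_tilde a) = 0.
  by apply: etrans h _; apply: (etrans (y := - (2 *: 0))) => //;
     rewrite scaler0 oppr0.
rewrite ca' cd_mulNl cd_mulNr (cd_anticomm ca' cb) // opprK.
rewrite (cd_mul_tildel _ pa) (cd_mul_tildel _ pb) (cd_anticomm ca cb) //.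
rewrite cd_tildeN opprK -opprD => /eqP.
by rewrite oppr_eq0 => /eqP/cd_double_eq0/cd_tilde_eq0.
Qed.

(** The first half of the product is twice [a ** b]; the second is [a ** a - b ** b], zero because
    both squares are -1. *)
Lemma KerL_hatE : KerL alpha (cd_hat alpha) <-> a ** b = 0.
Proof.
have [ca cb] := (dpure_conj pa, dpure_conj pb).
have E : alpha ** cd_hat alpha = (a ** b + a ** b, 0).
  rewrite [LHS]cd_mulE; cbv [cd_hat fst snd].
  by rewrite ca cb cd_mulNl cd_mulNr opprK !cd_sqr_pure // aa bb opprK addNr.
split=> [| ab0]; last by rewrite /KerL /mkset E ab0 addr0.
rewrite /KerL /mkset E => /(congr1 fst) E1.
by apply: cd_double_eq0; exact: E1.
Qed.

Lemma KerL_orthC (U : {vspace CD R m.+2}) :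
  {in U, forall y, associator alpha alpha y = 0} ->
  KerL alpha `<=` orthC [set` U].
Proof.
move=> altU x ax0 y Uy; rewrite /KerL /mkset in ax0.
(* The adjoint of left multiplication by [alpha] is left multiplication by [- alpha]. *)
have := cd_dot_mull alpha x (alpha ** y).
rewrite ax0 cd_dot0l alpha_conj cd_mulNl alternative_alpha_mulK ?altU // opprK.
by rewrite cd_dotZr => /esym/eqP; rewrite mulf_eq0 pnatr_eq0 => /orP[//|/eqP].
Qed.

End ZeroDivisors.

Theorem theorem3p4 (R : realType) (n : nat) (alpha : CD R n.+1)
  (hn : (4 <= n)%N) (halpha : Wset R n alpha) :
  [<-> Xset R n alpha;
       associator alpha alpha (cd_eps R n) = 0;
       mul_closed (Vspan alpha) /\ alg_isom (Vspan alpha) 2;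
       mul_closed (Ospan alpha) /\ alg_isom (Ospan alpha) 3;
       KerL alpha (cd_hat alpha) /\ KerL alpha `<=` orthC [set` Ospan alpha]].
Proof.
(* The bound on [n] excludes [n = 0], where [cd_tone] and [cd_tilde] are junk. *)
case: n alpha hn halpha => [//|m] alpha _.
have [a [b ->]] : exists a b : CD R m.+1, alpha = (a, b).
  by exists alpha.1, alpha.2; case: alpha.
case=> [[/doubly_pureP pa /doubly_pureP pb] [na nb] ab ab'].
have dot1 (x : CD R m.+1) : cd_norm x = 1 -> cd_dot x x = 1.
  by move=> nx; rewrite -[LHS]sqr_sqrtr ?cd_dot_ge0 // [Num.sqrt _]nx expr1n.
have [aa bb] := (dot1 _ na, dot1 _ nb).
have ab0_of_isoV :
    alg_isom (Vspan ((a, b) : CD R m.+2)) 2 -> a ** b = 0.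
  move=> V2; apply: alternative_eps_mul0 => //.
  apply: (alg_isom_alternative (@quaternion_alternative R) V2).
    by apply: memv_span; rewrite !inE eqxx ?orbT.
  by apply: memv_span; rewrite !inE eqxx ?orbT.
have alt_of_isoO :
    alg_isom (Ospan ((a, b) : CD R m.+2)) 3 ->
    {in Ospan ((a, b) : CD R m.+2), forall y,
      associator ((a, b) : CD R m.+2) (a, b) y = 0}.
  move=> O3 y Oy.
  apply: (alg_isom_alternative (@octonion_alternative R) O3) => //.
  by apply: memv_span; rewrite !inE eqxx ?orbT.
have eps_O : cd_eps R m.+1 \in Ospan ((a, b) : CD R m.+2).
  by apply: memv_span; rewrite !inE eqxx ?orbT.
have isoO ab0 := alg_isom_Ospan pa pb aa bb ab ab' ab0.
have isoV ab0 := alg_isom_Vspan pa pb aa bb ab ab' ab0.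
tfae.
(* From (i) to (ii) through the octonions: [alpha] alternates with all of O_alpha, which contains
   [eps]. *)
- by case=> _ _ /isoO/alt_of_isoO; apply.
- move=> /alternative_eps_mul0 ab0.
  have V2 := isoV (ab0 pa pb aa bb ab ab').
  by split; [exact: alg_isom_mul_closed V2|].
- case=> _ /ab0_of_isoV/isoO O3.
  by split; [exact: alg_isom_mul_closed O3|].
(* Alternation on all of O_alpha gives the kernel inclusion; its instance at [eps] gives
   [a ** b = 0], hence the membership of [cd_hat alpha]. *)
- case=> _ /alt_of_isoO altO; split; last exact: KerL_orthC.
  by apply/KerL_hatE => //; apply: alternative_eps_mul0 (altO _ eps_O).
- by case=> /KerL_hatE ab0 _; split=> //; apply: ab0.
Qed.
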